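(* There is an absolute constant $K$ such that for all integers $m\ge1$ and $r$ with $\lceil\frac{m-1}{2}\rceil\le r\le m$, there is a unitary encoder $U(r,m)$ of $\mathrm{QRM}(r,m)$ on $n=2^m$ qubits that is realized by a circuit consisting of Hadamard gates, CNOT gates and qubit permutations, whose depth is at most $K m$ (that is, $O(\log n)$), and whose number of CNOT gates is $\zeta(r,m)$, where $\zeta$ is defined recursively by $$\zeta(m,m)=m2^{m-1},\qquad \zeta(r,m)=\sum_{i=m-r-1}^{r}\binom{m-1}{i}+2\,\zeta(r,m-1)\quad\text{for } \tfrac{m-1}{2}\le r<m .$$
   Context: For $0\le r\le m$, $\mathrm{RM}(r,m)\subseteq\mathbb F_2^{2^m}$ is the binary Reed-Muller code: the set of evaluation vectors $\mathrm{Eval}^{(m)}(f)=(f(\boldsymbol\rho(1)),\dots,f(\boldsymbol\rho(2^m)))$ of polynomials $f\in\mathbb F_2[x_1,\dots,x_m]$ of degree at most $r$, where $\boldsymbol\rho(j)$ is the $m$-bit binary representation of $j-1$. Set $\mathrm{RM}(s,m)=\{\mathbf 0\}$ for $s<0$. One has $\mathrm{RM}(r,m)^\perp=\mathrm{RM}(m-r-1,m)$. For $r\ge(m-1)/2$, $\mathrm{QRM}(r,m)$ is the CSS code with codewords $|\mathbf w\rangle_{r,m}=|\mathrm{RM}(r,m)^\perp|^{-1/2}\sum_{\mathbf c\in\mathrm{RM}(r,m)^\perp}|\mathbf w\oplus\mathbf c\rangle$, $\mathbf w\in\mathrm{RM}(r,m)$; it encodes $k=\sum_{i=m-r}^{r}\binom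 mi$ qubits. A unitary $U$ on $2^m$ qubits is a unitary encoder of $\mathrm{QRM}(r,m)$ if, for every $\mathbf m\in\mathbb F_2^k$, $U|\mathbf m\rangle|0\rangle^{\otimes(2^m-k)}=|\mathbf m G_1\rangle_{r,m}$, where $G_1$ is the $k\times 2^m$ matrix whose rows (in some fixed order) are the evaluation vectors of the monomials in $x_1,\dots,x_m$ of degree between $m-r$ and $r$ (extended linearly to superpositions of messages). Qubit permutations are relabelings of qubits and are not counted in the gate count or the depth; depth is the number of layers of gates acting on disjoint qubits. *)

(* Defs.v *)
From mathcomp Require Import all_boot all_order all_fingroup all_algebra.
From mathcomp Require Import boolp reals complex mpoly.

Set Implicit Arguments.
Unset Strict Implicit.
Unset Printing Implicit Defensive.

Import GRing.Theory Num.Theory.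

Local Open Scope ring_scope.

(** * Reed-Muller codes *)

(* The most significant bit is the value of the first variable.  The length
   2^m word is indexed from 0, so [j] is the usual 1-based index minus one. *)
Definition rho (m : nat) (j : 'I_(2 ^ m)) (i : 'I_m) : 'F_2 :=
  (j %/ 2 ^ (m - i.+1))%N%:R.

Definition Eval (m : nat) (f : {mpoly 'F_2[m]}) : 'rV['F_2]_(2 ^ m) :=
  \row_j f.@[rho j].

(* [msize f] is one more than the degree of [f], and 0 when [f = 0]. *)
Definition RM (r m : nat) : {set 'rV['F_2]_(2 ^ m)} :=
  [set w | `[< exists2 f : {mpoly 'F_2[m]}, (msize f <= r.+1)%N & w = Eval f >]].

Definition dual (n : nat) (D : {set 'rV['F_2]_n}) : {set 'rV['F_2]_n} :=
  [set w | [forall c in D, w *m c^T == 0]].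

(** * Qubits, gates and circuits *)

Section Quantum.

Variable C : numClosedFieldType.

(* The computational basis of n qubits is indexed by bit vectors, so the
   state space has dimension #|'rV['F_2]_n| = 2 ^ n. *)
Definition qdim (n : nat) : nat := #|{: 'rV['F_2]_n}|.

Definition ket (n : nat) (w : 'rV['F_2]_n) : 'cV[C]_(qdim n) :=
  delta_mx (enum_rank w) 0.

(* The operator sending |w> to [F w], i.e. the sum of the F(w)<w|. *)
Definition op_of (n : nat) (F : 'rV['F_2]_n -> 'cV[C]_(qdim n)) :
    'M[C]_(qdim n) :=
  \sum_w F w *m (ket w)^T.

Inductive gate (n : nat) : Type :=
| Hadamard of 'I_n
| CNOT of 'I_n & 'I_n.  (* control, then target *)

Definition gate_qubits (n : nat) (g : gate n) : seq 'I_n :=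
  match g with Hadamard i => [:: i] | CNOT c t => [:: c; t] end.

Definition is_cnot (n : nat) (g : gate n) : bool :=
  if g is CNOT _ _ then true else false.

Definition set_bit (n : nat) (w : 'rV['F_2]_n) (i : 'I_n) (b : 'F_2) :
    'rV['F_2]_n :=
  \row_j (if j == i then b else w 0 j).

Definition gate_mx (n : nat) (g : gate n) : 'M[C]_(qdim n) :=
  match g with
  | Hadamard i => op_of (fun w =>
      (sqrtC 2)^-1 *:
        \sum_(b : 'F_2) (-1) ^+ ((w 0 i * b)%R : 'F_2) *: ket (set_bit w i b))
  | CNOT c t => op_of (fun w => ket (set_bit w t (w 0 t + w 0 c)))
  end.

Definition perm_op (n : nat) (s : 'S_n) : 'M[C]_(qdim n) :=
  op_of (fun w => ket (col_perm s w)).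

Inductive step (n : nat) : Type :=
| Layer of seq (gate n)
| QPerm of 'S_n.

Definition circuit (n : nat) : Type := seq (step n).

(* The gates of a layer act on pairwise disjoint sets of qubits; this also
   forces control and target of each CNOT to differ. *)
Definition wf_step (n : nat) (s : step n) : bool :=
  if s is Layer gs then uniq (flatten (map (@gate_qubits n) gs)) else true.

Definition wf_circuit (n : nat) (c : circuit n) : bool := all (@wf_step n) c.

(* Heads of lists act first. *)
Definition step_mx (n : nat) (s : step n) : 'M[C]_(qdim n) :=
  match s with
  | Layer gs => foldl (fun M g => gate_mx g *m M) 1%:M gs
  | QPerm s => perm_op s
  end.

Definition circuit_mx (n : nat) (c : circuit n) : 'M[C]_(qdim n) :=
  foldl (fun M s => step_mx s *m M) 1%:M c.

Definition depth (n : nat) (c : circuit n) : nat :=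
  count (fun s => if s is Layer _ then true else false) c.

Definition cnot_count (n : nat) (c : circuit n) : nat :=
  sumn [seq if s is Layer gs then count (@is_cnot n) gs else 0%N | s <- c].

(** * Quantum Reed-Muller codes *)

Definition codeword (r m : nat) (w : 'rV['F_2]_(2 ^ m)) :
    'cV[C]_(qdim (2 ^ m)) :=
  (sqrtC #|dual (RM r m)|%:R)^-1 *: \sum_(c in dual (RM r m)) ket (w + c).

Definition qrm_dim (r m : nat) : nat :=
  (\sum_(m - r <= i < r.+1) 'C(m, i))%N.

(* The monomials are square-free (x^2 and x have the same evaluations), so they
   are given by sets of variables. *)
Definition monomial (m : nat) (A : {set 'I_m}) : {mpoly 'F_2[m]} :=
  \prod_(i in A) 'X_i.

Definition monomial_order (r m : nat) (s : (qrm_dim r m).-tuple {set 'I_m}) :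
    Prop :=
  uniq s /\ forall A : {set 'I_m}, (A \in s) = (m - r <= #|A| <= r)%N.

Definition G1 (r m : nat) (s : (qrm_dim r m).-tuple {set 'I_m}) :
    'M['F_2]_(qrm_dim r m, 2 ^ m) :=
  \matrix_(i < qrm_dim r m) Eval (monomial (tnth s i)).

(* The n-bit string x0...0. *)
Definition pad0 (n k : nat) (x : 'rV['F_2]_k) : 'rV['F_2]_n :=
  \row_(j < n) oapp (fun i : 'I_k => x 0 i) 0 (insub (j : nat)).

Definition unitary_encoder (r m : nat)
    (s : (qrm_dim r m).-tuple {set 'I_m}) (U : 'M[C]_(qdim (2 ^ m))) : Prop :=
  U \is unitarymx /\
  forall x : 'rV['F_2]_(qrm_dim r m),
    U *m ket (pad0 (2 ^ m) x) = codeword r (x *m G1 s).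

End Quantum.

Fixpoint zeta (r m : nat) : nat :=
  if r == m then (m * 2 ^ (m - 1))%N else
  if m is m'.+1 then
    (\sum_(m - r - 1 <= i < r.+1) 'C(m - 1, i) + 2 * zeta r m')%N
  else 0%N.

(* There are qrm_dim r m square-free monomials of degree between m - r and r,
   so they can always be listed in some order. *)
Lemma monomial_order_ex (r m : nat) :
  exists s : (qrm_dim r m).-tuple {set 'I_m}, monomial_order s.
Proof.
pose P := [set A : {set 'I_m} | (m - r <= #|A| <= r)%N].
suff sP : size (enum P) == qrm_dim r m.
  exists (Tuple sP); split=> [|A]; first exact: enum_uniq.
  by rewrite mem_enum inE.
rewrite -cardE -sum1_card /qrm_dim; apply/eqP.
under [RHS]eq_bigr => i _.
  rewrite -[X in 'C(X, _)](card_ord m) -card_draws -sum1dep_card big_mkcond.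
  over.
rewrite exchange_big big_mkcond /=; apply: eq_bigr => A _.
rewrite -big_mkcond sum1_count inE.
have -> : count (fun i => #|A| == i) (index_iota (m - r) r.+1) =
          count_mem #|A| (index_iota (m - r) r.+1).
  by apply: eq_count => i /=; rewrite eq_sym.
by rewrite count_uniq_mem ?iota_uniq // mem_index_iota ltnS; case: ifP.
Qed.

(* Main.v *)
Require Import Defs.
From mathcomp Require Import all_boot all_order all_fingroup all_algebra.
From mathcomp Require Import boolp reals complex mpoly.

Set Implicit Arguments.
Unset Strict Implicit.
Unset Printing Implicit Defensive.

Import GRing.Theory Num.Theory.

Local Open Scope ring_scope.

(* Index the qubits by the subsets A of the variables.  The full polar
   transform, which for each variable t applies the CNOT gates from A to t |: A
   for all A not containing t, sends the basis word e_A to the evaluation vector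
   of the monomial x_A.  The encoder loads the message on the e_A with
   m - r <= |A| <= r, puts a Hadamard gate on the qubits with |A| < m - r, and
   then runs a pruned polar transform: when t is processed and ts is the set of
   remaining variables, only the controls A with
   |ts| - r <= |A :&: ts| <= r are kept.  The controls with |A :&: ts| > r always
   carry 0, and those with |A :&: ts| < |ts| - r only change the result by an
   element of RM(m - r - 1, m), which is the dual code.  Hence the pruned
   transform maps the span of the e_A with |A| < m - r onto the dual code and
   agrees with the polar transform modulo the dual code on the message words.
   All Hadamard gates form one layer, so the depth is m + 1. *)

(** * Words indexed by sets of variables *)

Lemma F2_addxx (x : 'F_2) : x + x = 0.
Proof. by case: x => [[|[|//]] ?]; apply/val_inj. Qed.

Lemma F2_cases (x : 'F_2) : x = 0 \/ x = 1.
Proof. by case: x => [[|[|//]] ?]; [left|right]; apply/val_inj. Qed.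

Lemma F2_addKr (x y : 'F_2) : x + y + y = x.
Proof. by rewrite -addrA F2_addxx addr0. Qed.

Lemma F2_natr (k : nat) : k%:R = (odd k)%:R :> 'F_2.
Proof. by elim: k => [//|k IH]; rewrite mulrS IH /=; case: odd; apply/val_inj. Qed.

Lemma eq_from_low_bits (k a b : nat) : (a < 2 ^ k)%N -> (b < 2 ^ k)%N ->
  (forall i, (i < k)%N -> odd (a %/ 2 ^ i) = odd (b %/ 2 ^ i)) -> a = b.
Proof.
elim: k a b => [|k IH] a b; first by case: a b => [|//] [].
move=> lta ltb eqab.
rewrite -(odd_double_half a) -(odd_double_half b).
have := eqab 0 isT; rewrite !divn1 => ->; congr (_ + _.*2)%N.
apply: IH => [||i ltik]; rewrite -?divn2 ?ltn_divLR // -?expnSr //.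
by rewrite -!divnMA -expnS; apply: eqab.
Qed.

Section Points.

Variable m : nat.

Implicit Types (A B X : {set 'I_m}) (w v : 'rV['F_2]_(2 ^ m)).

Definition bits (j : 'I_(2 ^ m)) : {set 'I_m} := [set i | rho j i == 1].

Lemma in_bits i j : (i \in bits j) = odd (j %/ 2 ^ (m - i.+1)).
Proof. by rewrite in_set /rho F2_natr; case: (odd _). Qed.

Lemma bits_inj : injective bits.
Proof.
move=> j k /setP eqjk.
apply/val_inj/(eq_from_low_bits (ltn_ord j) (ltn_ord k)) => i ltim.
(* [rho] puts the most significant bit first, so the digit of weight [2 ^ i] is the value of
   variable [m - i - 1]. *)
have ltim' : (m - i.+1 < m)%N by rewrite ltn_subrL; case: (m) ltim.
by have := eqjk (Ordinal ltim'); rewrite !in_bits /= subnSK // subKn // ltnW.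
Qed.

Lemma card_qubits : #|{set 'I_m}| = (2 ^ m)%N.
Proof. by rewrite -cardsT -powersetT card_powerset cardsT card_ord. Qed.

Lemma bits_onto A : A \in codom bits.
Proof. by apply: inj_card_onto; [apply: bits_inj | rewrite card_qubits card_ord]. Qed.

Definition pt A : 'I_(2 ^ m) := iinv (bits_onto A).

Lemma ptK : cancel pt bits.
Proof. by move=> A; apply: f_iinv. Qed.

Lemma bitsK : cancel bits pt.
Proof. by move=> j; apply: bits_inj; apply: ptK. Qed.

Lemma pt_inj : injective pt. Proof. exact: can_inj ptK. Qed.

Lemma rho_pt A i : rho (pt A) i = (i \in A)%:R.
Proof.
rewrite -{2}(ptK A) in_set.
by case: (F2_cases (rho (pt A) i)) => ->.
Qed.

Lemma reindex_pt (V : nmodType) (F : 'I_(2 ^ m) -> V) :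
  \sum_j F j = \sum_A F (pt A).
Proof. by apply: reindex; exists bits => x _; [apply: ptK | apply: bitsK]. Qed.

(** * Words as functions on sets, and their transforms *)

Definition word (f : {set 'I_m} -> 'F_2) : 'rV['F_2]_(2 ^ m) :=
  \row_j f (bits j).

Lemma wordE f A : word f 0 (pt A) = f A.
Proof. by rewrite mxE ptK. Qed.

Lemma wordP w v : (forall A, w 0 (pt A) = v 0 (pt A)) -> w = v.
Proof. by move=> eqwv; apply/rowP => j; rewrite -[j]bitsK. Qed.

Lemma word_addK w v : w + v + v = w.
Proof. by apply/rowP => j; rewrite !mxE F2_addKr. Qed.

(* Over F_2 the Moebius and zeta transforms coincide; X is the set of variables
   in which the transform is taken. *)
Definition mobius X w : 'rV['F_2]_(2 ^ m) :=
  word (fun B =>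
    \sum_(A : {set 'I_m} | (A \subset B) && (B :\: A \subset X)) w 0 (pt A)).

Lemma mobiusD X w v : mobius X (w + v) = mobius X w + mobius X v.
Proof.
apply: wordP => B; rewrite [RHS]mxE !wordE -big_split /=.
by apply: eq_bigr => A _; rewrite mxE.
Qed.

(* The effect on words of the CNOT gates from A to t |: A, for A in D. *)
Definition butterfly (t : 'I_m) (D : {set {set 'I_m}}) w : 'rV['F_2]_(2 ^ m) :=
  word (fun B => w 0 (pt B) +
    (if (t \in B) && (B :\ t \in D) then w 0 (pt (B :\ t)) else 0)).

Lemma butterflyD t D w v :
  butterfly t D (w + v) = butterfly t D w + butterfly t D v.
Proof.
apply: wordP => B; rewrite [RHS]mxE !wordE !mxE.
by case: ifP; rewrite ?addr0 // addrACA.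
Qed.

(** Sources avoid [t] and stay unchanged, so a second pass adds the same bits again. *)
Lemma butterflyK t D : involutive (butterfly t D).
Proof.
move=> w; apply: wordP => B; rewrite !wordE setD11 /= addr0.
by case: ifP => _; rewrite ?addr0 ?F2_addKr.
Qed.

Lemma mobius0 w : mobius set0 w = w.
Proof.
apply: wordP => B; rewrite wordE (big_pred1 B) // => A /=.
by rewrite subset0 setD_eq0 -eqEsubset.
Qed.

(** The sets contributing at [B] only on the left are those missing [t] while [B] contains it; they
    have the form [A :\ t], and the butterfly adds exactly these terms. *)
Lemma mobiusU1 t X w : t \notin X ->
  mobius (t |: X) w = mobius X (butterfly t setT w).
Proof.
move=> tX; apply: wordP => B; rewrite !wordE.
under [RHS]eq_bigr => A _ do rewrite wordE in_setT andbT.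
rewrite big_split /= (bigID (fun A => (t \in A) || (t \notin B))) /=.
congr (_ + _).
  apply: eq_bigl => A; rewrite -andbA; apply: andb_id2l => AB.
  apply/andP/idP => [[sBA /orP tAB]|sBA]; last first.
    split; first by apply: subset_trans sBA (subsetUr _ _).
    rewrite orbC -implyNb negbK; apply/implyP => tB; apply: contraT => tA.
    by case/negP: tX; apply: (subsetP sBA); rewrite inE tA.
  apply/subsetP => i iBA; have := subsetP sBA i iBA; rewrite !inE.
  case/predU1P => [ei|//]; move: iBA; rewrite ei inE.
  by case: tAB => [->//|/negbTE->]; rewrite andbF.
rewrite -big_mkcondr /=.
rewrite (reindex_onto (fun A => A :\ t) (fun A => t |: A)) /=; last first.
  by move=> A /andP[_]; rewrite negb_or => /andP[tA _]; rewrite setU1K.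
apply: eq_bigl => A; rewrite setD11 /= negbK.
case tA: (t \in A); last first.
  rewrite andbF; apply/negP => /andP[_ /eqP eA].
  by move: tA; rewrite -eA setU11.
rewrite setD1K // eqxx !andbT.
apply/andP/andP => [[/andP[AB sBA] tB]|[AB sBA]].
  have sAB : A \subset B by rewrite -(setD1K tA) subUset sub1set tB.
  split=> //; apply/subsetP => i; rewrite inE => /andP[iA iB].
  have := subsetP sBA i; rewrite !inE (negbTE iA) andbF iB => /(_ isT).
  by case/predU1P => // ei; rewrite ei tA in iA.
have tB := subsetP AB t tA; split=> //; apply/andP; split.
  by apply: subset_trans AB; apply: subD1set.
apply/subsetP => i; rewrite !inE negb_and negbK => /andP[/orP[->//|iA] iB].
by rewrite orbC (subsetP sBA) // inE iA.
Qed.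

End Points.

(** * Duality of Reed-Muller codes *)

(** Toggling an element of [Y] outside [X] pairs off the sets in between, so their number is even
    unless [X = Y]. *)
Lemma F2_sum_interval (T : finType) (X Y : {set T}) : X \subset Y ->
  \sum_(A : {set T} | (X \subset A) && (A \subset Y)) (1 : 'F_2) =
    (X == Y)%:R.
Proof.
move=> sXY; have [eXY|neXY] := eqVneq X Y.
  by rewrite (big_pred1 Y) // => A /=; rewrite eXY eqEsubset andbC.
have /existsP[t /andP[tY tX]] : [exists t, (t \in Y) && (t \notin X)].
  apply: contraNT neXY => /existsPn nt; rewrite eqEsubset sXY /=.
  by apply/subsetP => t tY; have := nt t; rewrite tY negbK.
rewrite (bigID (fun A : {set T} => t \in A)) /=.
rewrite (reindex_onto (fun A => t |: A) (fun A : {set T} => A :\ t)) /=; last first.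
  by move=> A /andP[_]; apply: setD1K.
rewrite (eq_bigl (fun A : {set T} => (X \subset A) && (A \subset Y) && (t \notin A))).
  exact: F2_addxx.
move=> A; rewrite setU11 andbT subUset sub1set tY /=.
case tA: (t \in A).
  rewrite andbF; apply/negbTE/negP => /andP[_ /eqP eA].
  by rewrite -eA setD11 in tA.
rewrite setU1K ?tA // eqxx !andbT; congr (_ && _).
apply/idP/idP => sXA; last exact: subset_trans sXA (subsetUr _ _).
apply/subsetP => i iX; have := subsetP sXA i iX; rewrite !inE.
by case/predU1P => // ei; rewrite -ei iX in tX.
Qed.

Section Duality.

Variable m : nat.

Implicit Types (A B X : {set 'I_m}) (w v : 'rV['F_2]_(2 ^ m)).

Lemma mobiusT w B : mobius setT w 0 (pt B) = \sum_(A : {set 'I_m} | A \subset B) w 0 (pt A).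
Proof. by rewrite wordE; apply: eq_bigl => A; rewrite subsetT andbT. Qed.

(** The coefficient of the entry at [C] in the double transform at [B] counts the sets between [C]
    and [B], which is odd only for [C = B]. *)
Lemma mobiusTK : involutive (@mobius m setT).
Proof.
move=> w; apply: wordP => B; rewrite mobiusT.
under eq_bigr => A _ do rewrite mobiusT.
rewrite (exchange_big_dep (fun C : {set 'I_m} => C \subset B)) /=; last first.
  by move=> A C AB CA; apply: subset_trans AB.
rewrite (bigD1 B) //= [X in _ + X]big1 => [|C /andP[sCB neCB]].
  rewrite addr0 (big_pred1 B) // => A /=.
  by rewrite eqEsubset.
under eq_bigr => A _ do rewrite -[w 0 _]mul1r.
rewrite -mulr_suml (eq_bigl (fun A : {set _} => (C \subset A) && (A \subset B))).
  by rewrite F2_sum_interval // (negbTE neCB) mul0r.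
by move=> A; rewrite andbC.
Qed.

(** [mobius X] factors into one full butterfly per variable of [X], each an involution. *)
Lemma mobius_inj X : injective (mobius X).
Proof.
move: {2}#|X| (erefl #|X|) => k; elim: k X => [|k IH] X.
  by move=> /cards0_eq -> w v; rewrite !mobius0.
move=> eX; have /card_gt0P[t tX] : (0 < #|X|)%N by rewrite eX.
move=> w v; rewrite -(setD1K tX) !mobiusU1 ?setD11 // => /IH eqb.
apply: (can_inj (butterflyK t setT)); apply: eqb.
by move: eX; rewrite (cardsD1 t) tX => -[].
Qed.

(** Inner product of [w] with the evaluation vector of the monomial of [A], which is 1 exactly at
    the supersets of [A]. *)
Definition upsum w A := \sum_(B : {set 'I_m} | A \subset B) w 0 (pt B).

(* A subset C contributes once for each A inside B :&: C, hence an odd number of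
   times only when B and C are disjoint. *)
Lemma mobius_upsum w B :
  mobius setT w 0 (pt (~: B)) = \sum_(A : {set 'I_m} | A \subset B) upsum w A.
Proof.
rewrite mobiusT (exchange_big_dep predT) //= big_mkcond /=.
apply: eq_bigr => C _.
under eq_bigr => A _ do rewrite -[w 0 _]mul1r.
rewrite -mulr_suml.
rewrite (eq_bigl (fun A : {set _} => (set0 \subset A) && (A \subset B :&: C))); last first.
  by move=> A; rewrite sub0set subsetI.
rewrite F2_sum_interval ?sub0set // eq_sym setI_eq0 disjoint_sym disjoints_subset.
by case: ifP => _; rewrite ?mul1r ?mul0r.
Qed.

(** Through [mobius setT], these are the coefficient vectors of square-free polynomials of degree
    below [d]. *)
Definition low (d : nat) : {set 'rV['F_2]_(2 ^ m)} :=
  [set w : 'rV_(2 ^ m) | [forall A : {set 'I_m}, (d <= #|A|)%N ==> (w 0 (pt A) == 0)]].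

Lemma lowP d w :
  reflect (forall A, (d <= #|A|)%N -> w 0 (pt A) = 0) (w \in low d).
Proof.
rewrite inE; apply: (iffP forallP) => [lw A dA|lw A].
  by apply/eqP; have /implyP := lw A; apply.
by apply/implyP => /lw ->.
Qed.

Lemma lowD d w v : w \in low d -> v \in low d -> w + v \in low d.
Proof. by move=> /lowP lw /lowP lv; apply/lowP => A dA; rewrite mxE lw ?lv ?addr0. Qed.

(** By [mobius_upsum], the transform at [~: A] is the sum of [upsum w] over the subsets of [A]; this
    system is triangular in the size of [A]. *)
Lemma upsum_low r w :
  (forall A, (#|A| <= r)%N -> upsum w A = 0) <-> (mobius setT w \in low (m - r)).
Proof.
have le_card A : (m - r <= #|A|)%N = (#|~: A| <= r)%N.
  by rewrite [#|~: A|]cardsCs setCK card_ord !leq_subLR addnC.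
split=> [w0|/lowP lw].
  apply/lowP => A; rewrite le_card => leAr.
  rewrite -[A]setCK mobius_upsum big1 // => B BA; apply: w0.
  by apply: leq_trans leAr; apply: subset_leq_card.
move=> A; move: {2}#|A| (leqnn #|A|) => k; elim: k A => [|k IH] A leAk leAr.
  have := lw (~: A); rewrite le_card setCK => /(_ leAr).
  move: leAk; rewrite leqn0 cards_eq0 => /eqP ->.
  by rewrite mobius_upsum (big_pred1 set0) // => B /=; rewrite subset0.
have := lw (~: A); rewrite le_card setCK => /(_ leAr).
rewrite mobius_upsum (bigD1 A) //= big1 ?addr0 // => B /andP[sBA neBA].
have ltBA : (#|B| < #|A|)%N by rewrite proper_card // properEneq neBA.
by apply: IH; [rewrite -ltnS; apply: leq_trans leAk | apply: leq_trans (ltnW ltBA) leAr].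
Qed.

(** * Evaluations of monomials and the dual code *)

Lemma EvalE (f : {mpoly 'F_2[m]}) A :
  Eval f 0 (pt A) = f.@[fun i => (i \in A)%:R].
Proof. by rewrite mxE; apply: meval_eq => i; apply: rho_pt. Qed.

Lemma prod_indicator (T : finType) (P : pred T) (B : {set T}) :
  \prod_(i | P i) (i \in B)%:R = ([set i | P i] \subset B)%:R :> 'F_2.
Proof.
case sPB: ([set i | P i] \subset B).
  by apply: big1 => i Pi; rewrite (subsetP sPB) ?inE.
have /subsetPn[j] := negbT sPB.
by rewrite inE => Pj jB; rewrite (bigD1 j) //= (negbTE jB) mul0r.
Qed.

Lemma Eval_monomial A B : Eval (monomial A) 0 (pt B) = (A \subset B)%:R.
Proof.
rewrite EvalE rmorph_prod /=.
under eq_bigr => i _ do rewrite mevalXU.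
by rewrite prod_indicator; have -> : [set i | i \in A] = A by apply/setP => i; rewrite inE.
Qed.

Lemma msize_monomial A : msize (monomial A) = #|A|.+1.
Proof.
rewrite /monomial (_ : \prod_(i in A) 'X_i = 'X_[\sum_(i in A) U_(i)]%MM).
  rewrite msizeX mdeg_sum; under eq_bigr => i _ do rewrite mdeg1.
  by rewrite sum1_card.
by elim/big_rec2: _ => [|i x p _ ->]; rewrite ?mpolyX0 // mpolyXD.
Qed.

Lemma dot_pt w v : (w *m v^T == 0) = (\sum_A w 0 (pt A) * v 0 (pt A) == 0).
Proof.
have -> : \sum_A w 0 (pt A) * v 0 (pt A) = (w *m v^T) 0 0.
  by rewrite mxE reindex_pt; apply: eq_bigr => A _; rewrite mxE.
apply/eqP/eqP => [->|e0]; first by rewrite mxE.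
by apply/matrixP => i j; rewrite !ord1 e0 mxE.
Qed.

(** At points with coordinates 0 and 1 a monomial depends only on the set of variables occurring in
    it. *)
Lemma dot_meval w (mon : 'X_{1..m}) :
  \sum_A w 0 (pt A) * \prod_i (i \in A)%:R ^+ mon i =
    upsum w [set i | mon i != 0%N].
Proof.
rewrite /upsum [RHS]big_mkcond; apply: eq_bigr => A _.
rewrite (eq_bigr (fun i => if mon i != 0%N then (i \in A)%:R else 1)).
  rewrite -big_mkcond prod_indicator.
  by case: ifP => _; rewrite ?mulr1 ?mulr0.
by move=> i _; case: (mon i) => //= k; case: (i \in A); rewrite ?expr1n ?expr0n.
Qed.

(** This is the duality of [RM(r, m)] and [RM(m - r - 1, m)], as [mobius setT w] holds the
    coefficients of the polynomial with values [w]. One direction tests against square-free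
    monomials, the other expands [f] in monomials. *)
Lemma in_dual_RM r w : (w \in dual (RM r m)) = (mobius setT w \in low (m - r)).
Proof.
apply/idP/idP => [|/upsum_low w0]; rewrite inE.
  move=> /forallP dw; apply/upsum_low => A leAr.
  have /implyP := dw (Eval (monomial A)).
  have -> : Eval (monomial A) \in RM r m.
    by rewrite inE; apply/asboolP; exists (monomial A) => //; rewrite msize_monomial.
  rewrite dot_pt => /(_ isT)/eqP <-; rewrite /upsum big_mkcond.
  apply: eq_bigr => B _; rewrite Eval_monomial.
  by case: ifP => _; rewrite ?mulr1 ?mulr0.
apply/forall_inP => c; rewrite inE => /asboolP[f szf ->]; rewrite dot_pt.
under eq_bigr => A _ do rewrite EvalE mevalE mulr_sumr.
rewrite exchange_big big_seq big1 //= => mon mon_f.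
under eq_bigr => A _ do rewrite mulrCA.
rewrite -mulr_sumr dot_meval w0 ?mulr0 //.
apply: (@leq_trans (mdeg mon)); last first.
  by rewrite -ltnS; apply: leq_trans szf; apply: msize_mdeg_lt.
rewrite mdegE -sum1_card big_mkcond leq_sum // => i _.
by rewrite inE; case: (mon i).
Qed.

End Duality.

(** * The pruned polar transform *)

Section Encoder.

Variables m r : nat.

Implicit Types (A B X : {set 'I_m}) (w v : 'rV['F_2]_(2 ^ m)).

(* ts lists the variables still to be processed after t. *)
Definition controls (t : 'I_m) (ts : seq 'I_m) : {set {set 'I_m}} :=
  [set A : {set 'I_m} |
    (t \notin A) && (size ts - r <= #|A :&: [set i in ts]| <= r)%N].

Fixpoint encode (ts : seq 'I_m) (w : 'rV['F_2]_(2 ^ m)) :=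
  if ts is t :: ts' then encode ts' (butterfly t (controls t ts') w) else w.

Lemma encodeD ts w v : encode ts (w + v) = encode ts w + encode ts v.
Proof. by elim: ts w v => //= t ts IH w v; rewrite butterflyD IH. Qed.

Lemma encode_inj ts : injective (encode ts).
Proof.
elim: ts => [|t ts IH] w v //= /IH; exact: (can_inj (butterflyK _ _)).
Qed.

(** [mobius X] only combines entries at sets with the same part outside [X]. *)
Lemma mobius_fiber X w k :
  (forall A, (k <= #|A :\: X|)%N -> w 0 (pt A) = 0) ->
  forall B, (k <= #|B :\: X|)%N -> mobius X w 0 (pt B) = 0.
Proof.
move=> w0 B leB; rewrite wordE big1 // => A /andP[AB sBA]; apply: w0.
rewrite (_ : A :\: X = B :\: X) //; apply/eqP.
rewrite eqEsubset setSD //=; apply/subsetP => i; rewrite !inE.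
case/andP => iX iB; rewrite iX /=; apply: contraR iX => iA.
by apply: (subsetP sBA); rewrite inE iA.
Qed.

(* Here ~: ts is the set of variables processed before w was obtained.  As the
   unpruned steps are involutions, mobius (~: ts) w is the word from which they
   would have produced w, and pruning the remaining steps changes the inverse
   transform of the result only in low degrees. *)
Lemma mobius_encode ts w : uniq ts ->
  (forall A, (r < #|A :&: [set i in ts]|)%N -> w 0 (pt A) = 0) ->
  mobius setT (encode ts w) + mobius (~: [set i in ts]) w \in low m (m - r).
Proof.
elim: ts w => [|t ts IH] w /= => [_ _|/andP[tts uts] w0].
  rewrite (_ : [set i in [::]] = set0) ?setC0; last first.
    by apply/setP => i; rewrite !inE.
  by apply/lowP => A _; rewrite mxE F2_addxx.
have drop_t A : (A :\ t) :&: [set i in ts] = A :&: [set i in ts].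
  by apply/setP => i; rewrite !inE; case: eqP => // ->; rewrite (negbTE tts) !andbF.
set w' := butterfly t _ w.
(* The invariant survives: [A] and [t |: A] have the same trace on [ts], and controls with a trace
   larger than [r] are pruned. *)
have w'0 A : (r < #|A :&: [set i in ts]|)%N -> w' 0 (pt A) = 0.
  move=> ltA; rewrite wordE w0; last first.
    apply: leq_trans ltA _; apply: subset_leq_card; apply: setIS.
    by apply/subsetP => i; rewrite !inE orbC => ->.
  rewrite add0r; case: ifP => // /andP[tA]; rewrite inE => /and3P[_ _].
  by rewrite drop_t leqNgt ltA.
have tX : t \notin ~: [set i in t :: ts] by rewrite !inE eqxx.
have eX : ~: [set i in ts] = t |: ~: [set i in t :: ts].
  apply/setP => i; rewrite !inE; case: eqP => //= ->.
  by rewrite tts.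
have -> : mobius (~: [set i in t :: ts]) w =
    mobius (~: [set i in ts]) (butterfly t setT w).
  by rewrite eX mobiusU1 // butterflyK.
(* The transform of [w'] is inserted twice: the induction hypothesis settles one pair, and the other
   measures the pruning of this step. *)
rewrite -(word_addK (mobius setT _) (mobius (~: [set i in ts]) w')) -addrA.
apply: lowD; first exact: IH.
rewrite -mobiusD; set v := w' + _.
(* [v] is what the dropped controls would have added; those with a trace above [r] carry 0, so only
   traces below [size ts - r] remain. *)
have v0 B : (size ts - r <= #|B :\: ~: [set i in ts]|)%N -> v 0 (pt B) = 0.
  rewrite setDE setCK => leB; rewrite mxE !wordE in_setT andbT addrACA F2_addxx add0r.
  case tB: (t \in B) => /=; last by rewrite addr0.
  rewrite inE setD11 drop_t leB /=; case: leqP => [_|ltB]; first exact: F2_addxx.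
  rewrite add0r w0 //; rewrite -drop_t in ltB; apply: leq_trans ltB _.
  by apply: subset_leq_card; apply: setIS; apply/subsetP => i; rewrite !inE orbC => ->.
(* At most [m - size ts] elements of [B] lie outside [ts], so [m - r <= #|B|] forces a trace of at
   least [size ts - r]. *)
apply/lowP => B leB; apply: mobius_fiber v0 _ _.
rewrite leq_subLR in leB; rewrite leq_subLR.
have cX : (size ts + #|~: [set i in ts]|)%N = m.
  by rewrite -[RHS]card_ord -(cardsC [set i in ts]) [#|[set _ in _]|]cardsE (card_uniqP uts).
rewrite -(leq_add2r #|~: [set i in ts]|) cX -addnA.
apply: leq_trans leB _; rewrite leq_add2l addnC.
rewrite -(cardsID (~: [set i in ts]) B) leq_add2r subset_leq_card //.
exact: subsetIr.
Qed.

Hypothesis mr : (m <= r.*2.+1)%N.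

Lemma mobius_encode_all w :
  (forall A, (r < #|A|)%N -> w 0 (pt A) = 0) ->
  mobius setT (encode (enum 'I_m) w) + w \in low m (m - r).
Proof.
move=> w0; have eT : [set i in enum 'I_m] = setT.
  by apply/setP => i; rewrite !inE mem_enum.
have := @mobius_encode (enum 'I_m) w (enum_uniq _).
by rewrite eT setCT mobius0; apply => A; rewrite setIT; apply: w0.
Qed.

(** One inclusion is [mobius_encode_all]; equality follows by counting, since [encode] is injective
    and [mobius setT] injects the dual code into [low]. *)
Lemma encode_low_dual : encode (enum 'I_m) @: low m (m - r) = dual (RM r m).
Proof.
apply/eqP; rewrite eqEcard; apply/andP; split.
  apply/subsetP => _ /imsetP[w lw ->]; rewrite in_dual_RM.
  rewrite -(word_addK (mobius _ _) w); apply: lowD => //.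
  apply: mobius_encode_all => A ltA; apply: (lowP _ _ lw).
  (* Here [m - r <= r + 1], so a low word vanishes on all sets larger than [r]. *)
  by rewrite leq_subLR (leq_trans mr) // -addnn -addnS leq_add2l.
rewrite (card_imset _ (@encode_inj _)) -(card_imset _ (@mobius_inj m setT)).
apply/subset_leq_card/subsetP => _ /imsetP[w dw ->].
by rewrite -in_dual_RM.
Qed.

Lemma encode_dual w :
  (forall A, (r < #|A|)%N -> w 0 (pt A) = 0) ->
  encode (enum 'I_m) w + mobius setT w \in dual (RM r m).
Proof.
by move=> w0; rewrite in_dual_RM mobiusD mobiusTK; apply: mobius_encode_all.
Qed.

End Encoder.

(** * Gate count *)

Section Counting.

Variables m r : nat.

(** The recursion of [zeta] continued down to 0, so that each processed variable contributes one
    term. *)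
Fixpoint cost (p : nat) : nat :=
  if p is p'.+1 then (\sum_(p' - r <= i < r.+1) 'C(p', i) + 2 * cost p')%N
  else 0%N.

(** Up to [r] the window contains all sizes, so each binomial sum is a full power of 2. *)
Lemma cost_full p : (p <= r)%N -> cost p = (p * 2 ^ (p - 1))%N.
Proof.
elim: p => [//|p IH] ltpr /=; rewrite IH 1?ltnW // subn1 /=.
have -> : (\sum_(p - r <= i < r.+1) 'C(p, i) = 2 ^ p)%N.
  have -> : (p - r = 0)%N by apply/eqP; rewrite subn_eq0 ltnW.
  rewrite (@big_cat_nat _ _ _ p.+1) //=; last by rewrite ltnS ltnW.
  rewrite [X in (_ + X)%N]big_nat_cond [X in (_ + X)%N]big1 ?addn0 => [|i]; last first.
    by rewrite andbT => /andP[ltpi _]; apply: bin_small.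
  by rewrite big_mkord -[2%N]/(1 + 1)%N expnDn; apply: eq_bigr => i _; rewrite !exp1n !muln1.
by case: p {IH ltpr} => [//|p]; rewrite subn1 /= mulnCA -expnS mulSn.
Qed.

Lemma zeta_cost p : (r <= p)%N -> zeta r p = cost p.
Proof.
elim: p => [|p IH]; first by rewrite leqn0 => /eqP ->.
rewrite leq_eqVlt => /predU1P[eqr|ltrp].
  by rewrite cost_full eqr //= eqxx.
rewrite /= (negbTE (_ : r != p.+1)); last by rewrite neq_ltn ltrp.
by rewrite IH // subn1 /= subnS subSn.
Qed.

Lemma card_bounded_subsets (U : {set 'I_m}) a :
  #|[set B : {set 'I_m} | (B \subset U) && (a <= #|B| <= r)%N]| =
    (\sum_(a <= i < r.+1) 'C(#|U|, i))%N.
Proof.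
under eq_bigr => i _ do rewrite -cards_draws -sum1_card big_mkcond.
rewrite exchange_big -sum1_card big_mkcond /=; apply: eq_bigr => B _.
rewrite inE; case sBU: (B \subset U) => /=; last first.
  by rewrite big1 // => i _; rewrite inE sBU.
rewrite (eq_bigr (fun i => if i == #|B| then 1 else 0)%N); last first.
  by move=> i _; rewrite inE sBU eq_sym.
rewrite -big_mkcond sum1_count count_uniq_mem ?iota_uniq // mem_index_iota ltnS.
by case: ifP.
Qed.

(** A control joins an arbitrary set of variables outside [t :: ts] with a subset of [ts] of
    admissible size. *)
Lemma card_controls t (ts : seq 'I_m) : uniq (t :: ts) ->
  #|controls r t ts| = (2 ^ (m - (size ts).+1) *
     \sum_(size ts - r <= i < r.+1) 'C(size ts, i))%N.
Proof.
move=> uts; set T := [set i in ts].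
have cT : #|T| = size ts by case/andP: uts => _ /card_uniqP <-; rewrite cardsE.
have cts : #|~: (t |: T)| = (m - (size ts).+1)%N.
  rewrite cardsCs setCK card_ord cardsU1 cT inE.
  by case/andP: uts => -> _.
pose D := [set B : {set 'I_m} | (B \subset T) && (size ts - r <= #|B| <= r)%N].
pose J (p : {set 'I_m} * {set 'I_m}) := p.1 :|: p.2.
have JI (Y B : {set 'I_m}) : Y \subset ~: (t |: T) -> B \subset T -> (Y :|: B) :&: T = B.
  move=> sY sB; apply/setP => i; rewrite !inE; case iB: (i \in B).
    by rewrite orbT; have := subsetP sB i iB; rewrite inE => ->.
  rewrite orbF; apply/negP => /andP[iY iT].
  by have := subsetP sY i iY; rewrite !inE iT orbT.
have JD (Y B : {set 'I_m}) : Y \subset ~: (t |: T) -> B \subset T -> (Y :|: B) :\: T = Y.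
  move=> sY sB; apply/setP => i; rewrite !inE; case iT: (i \in ts) => /=.
    apply/esym/negP => iY.
    by have := subsetP sY i iY; rewrite !inE iT orbT.
  case iB: (i \in B); last by rewrite orbF.
  by have := subsetP sB i iB; rewrite inE iT.
have -> : controls r t ts = J @: setX (powerset (~: (t |: T))) D.
  apply/setP => A; apply/idP/imsetP => [|[[Y B]]].
    rewrite inE => /andP[tA rA]; exists (A :\: T, A :&: T); last first.
      by rewrite /J /= setUC setID.
    rewrite !inE subsetIr rA !andbT; apply/subsetP => i; rewrite !inE.
    case/andP => iT iA; rewrite negb_or iT andbT.
    by apply: contraNneq tA => <-.
  rewrite !inE /= => /and3P[sY sB rB] ->; rewrite /J /= JI // rB andbT.
  rewrite !inE; apply/norP; split.
    by apply/negP => tY; have := subsetP sY t tY; rewrite !inE eqxx.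
  apply/negP => tB; have := subsetP sB t tB; rewrite inE.
  by case/andP: uts => /negbTE ->.
rewrite card_in_imset => [|[Y B] [Y' B']].
  by rewrite cardsX card_powerset cts card_bounded_subsets cT.
rewrite !inE /J /= => /and3P[sY sB _] /and3P[sY' sB' _] eJ.
by congr pair; [rewrite -(JD _ _ sY sB) eJ JD | rewrite -(JI _ _ sY sB) eJ JI].
Qed.

(** * The CNOT layers and their number of gates *)

Definition encoder_layer t ts : seq (gate (2 ^ m)) :=
  [seq CNOT p.1 p.2 | p <- [seq (pt A, pt (t |: A)) | A <- enum (controls r t ts)]].

Fixpoint encoder_layers (ts : seq 'I_m) : circuit (2 ^ m) :=
  if ts is t :: ts' then Layer (encoder_layer t ts') :: encoder_layers ts'
  else [::].

(** Processed variables are free in every control, whence the power of 2; its doubling at each step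
    matches the factor 2 in [cost]. *)
Lemma cnot_count_layers ts : uniq ts ->
  cnot_count (encoder_layers ts) = (2 ^ (m - size ts) * cost (size ts))%N.
Proof.
elim: ts => [|t ts IH] uts; first by rewrite muln0.
rewrite /cnot_count /= -/(cnot_count _) IH; last by case/andP: uts.
rewrite (_ : count _ _ = #|controls r t ts|); last first.
  by rewrite !count_map /= cardE count_predT.
have le_ts : (size ts < m)%N.
  by have := max_card (mem (t :: ts)); rewrite (card_uniqP uts) card_ord.
rewrite card_controls // mulnDr; congr (_ + _)%N.
by rewrite mulnA -expnSr subnSK.
Qed.

Lemma depth_layers ts : depth (encoder_layers ts) = size ts.
Proof. by elim: ts => //= t ts; rewrite /depth /= => ->. Qed.

End Counting.

(** * Circuits acting on basis states *)

Section Quantum.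

Variables (C : numClosedFieldType) (n : nat).

Implicit Types (u v w : 'rV['F_2]_n) (g : gate n) (h : 'I_n) (hs : seq 'I_n).

Notation ket := (@ket C n).

Lemma op_ofE (F : 'rV['F_2]_n -> 'cV[C]_(qdim n)) w : op_of F *m ket w = F w.
Proof.
rewrite mulmx_suml (bigD1 w) //= big1 => [|v neqvw].
  rewrite addr0 -mulmxA trmx_delta mul_delta_mx.
  by rewrite (_ : delta_mx 0 0 = 1%:M) ?mulmx1 //; apply/matrixP => i j; rewrite !mxE !ord1.
by rewrite -mulmxA trmx_delta mul_delta_mx_cond (inj_eq enum_rank_inj) (negbTE neqvw) mulmx0.
Qed.

Lemma eq_on_ket (M N : 'M[C]_(qdim n)) :
  (forall w, M *m ket w = N *m ket w) -> M = N.
Proof.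
move=> eqMN; apply/matrixP => i j.
have := congr1 (fun v : 'cV_(qdim n) => v i 0) (eqMN (enum_val j)).
by rewrite /ket /Defs.ket enum_valK -!colE !mxE.
Qed.

(** The adjoint of the permutation matrix of [f] is that of its inverse. *)
Lemma op_ket_unitary (f f' : 'rV['F_2]_n -> 'rV['F_2]_n) :
  cancel f f' -> cancel f' f ->
  op_of (fun w => ket (f w)) \is unitarymx.
Proof.
move=> fK f'K; apply/unitarymxP.
rewrite (_ : _ ^t*%sesqui = op_of (fun w => ket (f' w))).
  by apply: eq_on_ket => w; rewrite -mulmxA !op_ofE f'K mul1mx.
rewrite /op_of raddf_sum /= raddf_sum /=.
rewrite (reindex f') /=; last by exists f => w _; rewrite ?fK ?f'K.
apply: eq_bigr => w _; rewrite f'K trmx_mul trmxK map_mxM.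
by rewrite trmx_delta !map_delta_mx.
Qed.

(** * Single gates: action on basis states and unitarity *)

Lemma set_bitE w t b : set_bit w t b = w + (w 0 t + b) *: delta_mx 0 t.
Proof.
apply/rowP => j; rewrite !mxE eqxx /=; case: eqP => [->|_]; last by rewrite mulr0 addr0.
by rewrite mulr1 addrA F2_addxx add0r.
Qed.

Lemma CNOT_ket c t w :
  gate_mx C (CNOT c t) *m ket w = ket (w + w 0 c *: delta_mx 0 t).
Proof. by rewrite op_ofE set_bitE addrA F2_addxx add0r. Qed.

Lemma CNOT_unitary (c t : 'I_n) : c != t -> gate_mx C (CNOT c t) \is unitarymx.
Proof.
move=> neqct.
have fK : involutive (fun w : 'rV['F_2]_n => set_bit w t (w 0 t + w 0 c)).
  move=> w; apply/rowP => j; rewrite !mxE eqxx (negbTE neqct).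
  by case: eqP => // ->; rewrite F2_addKr.
exact: (op_ket_unitary fK fK).
Qed.

Lemma perm_ket (s : 'S_n) w : perm_op C s *m ket w = ket (col_perm s w).
Proof. exact: op_ofE. Qed.

Lemma perm_unitary (s : 'S_n) : perm_op C s \is unitarymx.
Proof.
apply: (@op_ket_unitary _ (col_perm s^-1)) => w;
  by apply/rowP => j; rewrite !mxE ?permK ?permKV.
Qed.

Lemma F2_sum (V : nmodType) (F : 'F_2 -> V) : \sum_b F b = F 0 + F 1.
Proof.
rewrite (bigD1 0) //= (bigD1 1) //= big_pred0 ?addr0 // => b.
by case: (F2_cases b) => ->.
Qed.

Lemma sqrt2V_sqr : (sqrtC 2 : C)^-1 * (sqrtC 2)^-1 * 2 = 1.
Proof.
rewrite -[X in _ * _ * X](sqrtCK 2) expr2 -invfM mulVf //.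
by rewrite mulf_neq0 // sqrtC_eq0 pnatr_eq0.
Qed.

Lemma Hadamard_ket i w : gate_mx C (Hadamard i) *m ket w =
  (sqrtC 2)^-1 *: (ket (set_bit w i 0) + (-1) ^+ (w 0 i == 1) *: ket (set_bit w i 1)).
Proof.
rewrite op_ofE F2_sum mulr0 mulr1 /= expr0 scale1r.
by case: (F2_cases (w 0 i)) => ->.
Qed.

Lemma set_bit_twice w i a b : set_bit (set_bit w i a) i b = set_bit w i b.
Proof. by apply/rowP => j; rewrite !mxE; case: eqP. Qed.

Lemma set_bit_id w i : set_bit w i (w 0 i) = w.
Proof. by apply/rowP => j; rewrite mxE; case: eqP => // ->. Qed.

Lemma Hadamard_sqr (i : 'I_n) : gate_mx C (Hadamard i) *m gate_mx C (Hadamard i) = 1%:M.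
Proof.
apply: eq_on_ket => w; rewrite mul1mx -mulmxA Hadamard_ket -scalemxAr mulmxDr.
rewrite -scalemxAr !Hadamard_ket !set_bit_twice ![set_bit _ _ _ 0 i]mxE eqxx /=.
rewrite expr0 expr1 scale1r scaleN1r [_ *: (_ *: _)]scalerA [_ * _^-1]mulrC -scalerA.
transitivity (((sqrtC 2)^-1 * (sqrtC 2)^-1 * 2 : C) *: ket w); last first.
  by rewrite sqrt2V_sqr scale1r.
rewrite -scalerDr scalerA -[RHS]scalerA; congr (_ *: _); rewrite scaler_nat mulr2n.
have -> : ket w = ket (set_bit w i (w 0 i)) by rewrite set_bit_id.
(* The two terms with the bit of [w] at [i] add up, and the two with the flipped bit cancel. *)
case: (F2_cases (w 0 i)) => -> /=.
  by rewrite expr0 scale1r addrACA subrr addr0.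
by rewrite expr1 scaleN1r opprB [X in X + _]addrC addrACA subrr addr0.
Qed.

Lemma HadamardE i u w :
  gate_mx C (Hadamard i) (enum_rank u) (enum_rank w) =
  (sqrtC 2)^-1 * ((-1) ^+ ((w 0 i == 1) && (u 0 i == 1)) *+ (set_bit w i (u 0 i) == u)).
Proof.
have := congr1 (fun v : 'cV_(qdim n) => v (enum_rank u) 0) (Hadamard_ket i w).
rewrite /ket /Defs.ket -colE !mxE !(inj_eq enum_rank_inj) !eqxx !andbT => ->.
congr (_ * _).
have neq b : b != u 0 i -> (u == set_bit w i b) = false.
  by apply: contraNF => /eqP ->; rewrite mxE eqxx.
case: (F2_cases (u 0 i)) => eu; rewrite eu /=.
  by rewrite (neq 1) ?eu // mulr0 addr0 andbF expr0 eq_sym.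
by rewrite (neq 0) ?eu // add0r andbT [u == _]eq_sym mulr_natr.
Qed.

(** The matrix is real and symmetric, and it squares to the identity. *)
Lemma Hadamard_unitary (i : 'I_n) : gate_mx C (Hadamard i) \is unitarymx.
Proof.
apply/unitarymxP; rewrite -[RHS](Hadamard_sqr i); congr (_ *m _).
apply/matrixP => j k; rewrite 2!mxE -[j]enum_valK -[k]enum_valK !HadamardE.
move: (enum_val j) (enum_val k) => u w.
rewrite rmorphM rmorphMn rmorphXn rmorphN1 /=.
rewrite andbC (_ : (set_bit u i (w 0 i) == w) = (set_bit w i (u 0 i) == u)).
  congr (_ * _); rewrite geC0_conj // invr_ge0 sqrtC_ge0 //.
by apply/eqP/eqP => e; rewrite -{1}e set_bit_twice set_bit_id.
Qed.

Lemma gate_unitary g : uniq (gate_qubits g) -> gate_mx C g \is unitarymx.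
Proof.
case: g => [i _|c t]; first exact: Hadamard_unitary.
by rewrite /= inE andbT; apply: CNOT_unitary.
Qed.

(** * Products of gates, layers and circuits *)

Lemma foldl_mulmx (T : Type) (F : T -> 'M[C]_(qdim n)) (s : seq T) (M : 'M_(qdim n)) :
  foldl (fun M x => F x *m M) M s = foldl (fun M x => F x *m M) 1%:M s *m M.
Proof.
elim: s M => [|x s IH] M /=; first by rewrite mul1mx.
by rewrite IH [in RHS]IH mulmx1 mulmxA.
Qed.

Lemma layer_cons g gs :
  step_mx C (Layer (g :: gs)) = step_mx C (Layer gs) *m gate_mx C g.
Proof. by rewrite /= foldl_mulmx mulmx1. Qed.

Lemma circuit_cons s (c : circuit n) :
  circuit_mx C (s :: c) = circuit_mx C c *m step_mx C s.
Proof. by rewrite /circuit_mx /= foldl_mulmx mulmx1. Qed.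

Lemma unitarymx1 k : (1%:M : 'M[C]_k) \is unitarymx.
Proof. by apply/unitarymxP; rewrite trmx1 map_mx1 mulmx1. Qed.

Lemma circuit_unitary (c : circuit n) : wf_circuit c -> circuit_mx C c \is unitarymx.
Proof.
elim: c => [_|s c IH]; first exact: unitarymx1.
case/andP => ws /IH wc; rewrite circuit_cons mul_unitarymx //.
case: s ws => [gs|s _]; last exact: perm_unitary.
rewrite /wf_step; elim: gs => [_|g gs IHg]; first exact: unitarymx1.
rewrite layer_cons /= cat_uniq => /and3P[ug _ /IHg ugs].
by rewrite mul_unitarymx // gate_unitary.
Qed.

(** The gates are disjoint, so no target is a later control and every gate reads the bits of the
    original [w]. *)
Lemma CNOT_layer_ket (ps : seq ('I_n * 'I_n)) w :
  uniq (flatten [seq gate_qubits (CNOT p.1 p.2) | p <- ps]) ->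
  step_mx C (Layer [seq CNOT p.1 p.2 | p <- ps]) *m ket w =
    ket (w + \sum_(p <- ps) w 0 p.1 *: delta_mx 0 p.2).
Proof.
elim: ps w => [|p ps IH] w ups; first by rewrite mul1mx big_nil addr0.
rewrite map_cons layer_cons -mulmxA CNOT_ket IH; last first.
  by move: ups; rewrite /= => /and3P[].
rewrite big_cons addrA; congr (ket (_ + _)).
apply: eq_big_seq => q qps; rewrite !mxE eqxx /=.
rewrite (_ : (q.1 == p.2) = false) ?mulr0 ?addr0 //; apply/negP => /eqP eq12.
move: ups => /= /and3P[_ p2ps _]; case/negP: p2ps; rewrite -eq12.
apply/flattenP; exists [:: q.1; q.2]; last by rewrite inE eqxx.
exact: (map_f (fun p => [:: p.1; p.2])).
Qed.

(** * Superpositions created by a Hadamard layer *)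

Definition supported (hs : seq 'I_n) : {set 'rV['F_2]_n} :=
  [set c : 'rV_n | [forall j, (j \notin hs) ==> (c 0 j == 0)]].

Lemma supportedP hs (c : 'rV['F_2]_n) :
  reflect (forall j, j \notin hs -> c 0 j = 0) (c \in supported hs).
Proof.
rewrite inE; apply: (iffP forallP) => [sc j jhs|sc j].
  by apply/eqP; have /implyP := sc j; apply.
by apply/implyP => /sc ->.
Qed.

Lemma big_supported_cons (V : nmodType) h hs (F : 'rV['F_2]_n -> V) :
  h \notin hs ->
  \sum_(c in supported (h :: hs)) F c =
    \sum_(c in supported hs) F c + \sum_(c in supported hs) F (delta_mx 0 h + c).
Proof.
move=> hhs; rewrite (bigID (fun c : 'rV_n => c 0 h == 0)) /=; congr (_ + _).
  apply: eq_bigl => c; apply/andP/supportedP => [[/supportedP sc /eqP ch] j jhs|sc].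
    by have [->//|njh] := eqVneq j h; apply: sc; rewrite inE negb_or njh.
  split; last by apply/eqP/sc.
  by apply/supportedP => j; rewrite inE negb_or => /andP[_ /sc].
have eK : involutive (fun c : 'rV['F_2]_n => delta_mx 0 h + c).
  by move=> c; apply/rowP => j; rewrite !mxE addrA F2_addxx add0r.
rewrite (reindex_inj (inv_inj eK)) /=; apply: eq_bigl => c.
rewrite !mxE !eqxx /=; apply/andP/supportedP => [[/supportedP sc ch] j jhs|sc].
  have [->|njh] := eqVneq j h.
    by move: ch; case: (F2_cases (c 0 h)) => ->.
  have := sc j; rewrite inE negb_or njh => /(_ jhs).
  by rewrite !mxE eqxx (negbTE njh) add0r.
rewrite (sc h hhs); split=> //; apply/supportedP => j.
rewrite inE negb_or => /andP[njh /sc cj].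
by rewrite !mxE eqxx (negbTE njh) cj addr0.
Qed.

Lemma supported0 (c : 'rV['F_2]_n) : (c \in supported [::]) = (c == 0).
Proof.
apply/supportedP/eqP => [c0|-> j _]; last by rewrite mxE.
by apply/rowP => j; rewrite c0 ?mxE.
Qed.

Lemma card_supported hs : uniq hs -> #|supported hs| = (2 ^ size hs)%N.
Proof.
elim: hs => [_|h hs IH /= /andP[hhs /IH chs]].
  by rewrite (eq_card (_ : _ =i pred1 0)) ?card1 // => c; rewrite supported0.
by rewrite -sum1_card big_supported_cons // sum1_card chs expnS mul2n -addnn.
Qed.

(** On a qubit holding 0 a Hadamard gate produces no sign: it keeps or flips the bit with equal
    amplitude. *)
Lemma Hadamard_layer_ket hs w : uniq hs -> {in hs, forall h, w 0 h = 0} ->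
  step_mx C (Layer [seq Hadamard h | h <- hs]) *m ket w =
    (sqrtC 2)^-1 ^+ size hs *: \sum_(c in supported hs) ket (w + c).
Proof.
elim: hs w => [|h hs IH] w.
  move=> _ _; rewrite mul1mx expr0 scale1r (big_pred1 0) ?addr0 // => c.
  exact: supported0.
rewrite cons_uniq => /andP[hhs uhs] w0.
rewrite map_cons layer_cons -mulmxA Hadamard_ket w0 ?mem_head //= expr0 scale1r.
rewrite !set_bitE !w0 ?mem_head // !add0r scale0r addr0 scale1r.
rewrite -scalemxAr mulmxDr !IH //; first last.
- by move=> j jhs; rewrite w0 // inE jhs orbT.
- move=> j jhs; rewrite !mxE w0 ?inE ?jhs ?orbT // add0r eqxx /=.
  by case: eqP => [ej|//]; rewrite -ej jhs in hhs.
rewrite -scalerDr scalerA -exprS big_supported_cons //; congr (_ *: (_ + _)).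
by apply: eq_bigr => c _; rewrite addrA.
Qed.

End Quantum.

(** * The encoder *)

(** [s] maps [j] to its index in [l] followed by the remaining positions. As [col_perm s] reads
    coordinate [s j] at [j], it carries the first coordinates to the positions in [l]. *)
Lemma perm_to_front n (l : seq 'I_n) : uniq l ->
  exists s : 'S_n, forall j : 'I_n,
    s j = index j l :> nat \/ (size l <= s j)%N /\ j \notin l.
Proof.
move=> ul; pose l' := l ++ [seq j <- enum 'I_n | j \notin l].
have l'P j : j \in l' by rewrite mem_cat mem_filter mem_enum andbT orbN.
have ul' : uniq l'.
  rewrite cat_uniq ul filter_uniq ?enum_uniq // andbT /=.
  by apply/hasPn => j; rewrite mem_filter => /andP[].
have szl' : size l' = n.
  by rewrite -(card_uniqP ul') -[RHS]card_ord; apply: eq_card => j; rewrite l'P.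
have lt_index j : (index j l' < n)%N by rewrite -[X in (_ < X)%N]szl' index_mem.
pose f j := Ordinal (lt_index j).
have f_inj : injective f.
  by move=> i j /(congr1 val) /= /index_inj; apply.
exists (perm f_inj) => j; rewrite permE /= index_cat; case: ifP => jl; [by left | right].
by split; rewrite ?leq_addr.
Qed.

Section EncoderCircuit.

Variables (C : numClosedFieldType) (m r : nat).

Implicit Types (A B : {set 'I_m}) (t : 'I_m) (ts : seq 'I_m)
  (w : 'rV['F_2]_(2 ^ m)).

(** Controls avoid [t], targets contain it, and [A] is recovered from [t |: A] by removing [t]. *)
Lemma encoder_layer_uniq t ts :
  uniq (flatten [seq gate_qubits g | g <- encoder_layer r t ts]).
Proof.
rewrite /encoder_layer -!map_comp /comp /=; set s := enum _.
have us : uniq s := enum_uniq _.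
have ts' A : A \in s -> t \notin A by rewrite mem_enum inE => /andP[].
elim: s us ts' => [//|A s IH] /= /andP[As us] ts'.
have /IH : forall B, B \in s -> t \notin B by move=> B Bs; apply: ts'; rewrite inE Bs orbT.
move=> /(_ us) ->; have tA : t \notin A by apply: ts'; rewrite mem_head.
rewrite inE (inj_eq (@pt_inj m)) negb_or andbT -andbA; apply/and3P; split.
- by apply: contraNneq tA => ->; rewrite setU11.
- apply/flattenP => -[_ /mapP[B Bs ->]] /=.
  rewrite !inE !(inj_eq (@pt_inj m)) => /orP[/eqP eAB|/eqP eAB].
    by rewrite eAB Bs in As.
  by rewrite eAB setU11 in tA.
apply/flattenP => -[_ /mapP[B Bs ->]] /=.
have tB : t \notin B by apply: ts'; rewrite inE Bs orbT.
rewrite !inE !(inj_eq (@pt_inj m)) => /orP[/eqP eAB|/eqP eAB].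
  by rewrite -eAB setU11 in tB.
by rewrite -(setU1K tA) eAB setU1K ?Bs // in As.
Qed.

Lemma encoder_layer_ket t ts w :
  step_mx C (Layer (encoder_layer r t ts)) *m ket C w =
    ket C (butterfly t (controls r t ts) w).
Proof.
rewrite CNOT_layer_ket; last first.
  by have := encoder_layer_uniq t ts; rewrite /encoder_layer -map_comp.
congr ket; apply: wordP => B; rewrite wordE mxE; congr (_ + _).
rewrite big_map big_enum summxE /=.
under eq_bigr => A _ do rewrite !mxE eqxx (inj_eq (@pt_inj m)) /=.
(* The only possible control for the target [B] is [B :\ t]. *)
case: ifP => [/andP[tB DB]|nB].
  rewrite (bigD1 (B :\ t)) //= setD1K // eqxx mulr1 big1 ?addr0 // => A /andP[DA neA].
  case: eqP => [eB|_]; last by rewrite mulr0.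
  move: DA neA; rewrite inE eB => /andP[tA _].
  by rewrite setU1K // eqxx.
rewrite big1 // => A DA; case: eqP => [eB|_]; last by rewrite mulr0.
move: nB; rewrite eB setU11 setU1K; first by rewrite DA.
by move: DA; rewrite inE => /andP[].
Qed.

Lemma wf_encoder_layers ts : wf_circuit (encoder_layers r ts).
Proof. by elim: ts => //= t ts ->; rewrite encoder_layer_uniq. Qed.

Lemma encoder_layers_ket ts w :
  circuit_mx C (encoder_layers r ts) *m ket C w = ket C (encode r ts w).
Proof.
elim: ts w => [|t ts IH] w; first by rewrite mul1mx.
by rewrite /encoder_layers -/encoder_layers circuit_cons -mulmxA encoder_layer_ket IH.
Qed.

Definition low_qubits : seq 'I_(2 ^ m) :=
  [seq pt A | A <- enum [set A : {set 'I_m} | (#|A| < m - r)%N]].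

Lemma mem_low_qubits A : (pt A \in low_qubits) = (#|A| < m - r)%N.
Proof. by rewrite mem_map ?mem_enum ?inE //; apply: pt_inj. Qed.

Lemma low_qubits_uniq : uniq low_qubits.
Proof. by rewrite map_inj_uniq ?enum_uniq //; apply: pt_inj. Qed.

Lemma supported_low : supported low_qubits = low m (m - r).
Proof.
apply/setP => w; apply/supportedP/lowP => w0.
  by move=> A leA; apply: w0; rewrite mem_low_qubits -leqNgt.
by move=> j; rewrite -[j]bitsK mem_low_qubits -leqNgt; apply: w0.
Qed.

End EncoderCircuit.

Section UnitaryEncoder.

Variables (C : numClosedFieldType) (m r : nat).
Hypothesis mr : (m <= r.*2.+1)%N.
Variable s : (qrm_dim r m).-tuple {set 'I_m}.
Hypothesis sP : monomial_order s.

Implicit Types (A B : {set 'I_m}) (w : 'rV['F_2]_(2 ^ m)).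

Definition load_message (x : 'rV['F_2]_(qrm_dim r m)) : 'rV['F_2]_(2 ^ m) :=
  \sum_i x 0 i *: delta_mx 0 (pt (tnth s i)).

Lemma load_message0 x A : A \notin s -> load_message x 0 (pt A) = 0.
Proof.
move=> sA; rewrite summxE big1 // => i _; rewrite !mxE eqxx (inj_eq (@pt_inj m)) /=.
case: eqP => [eA|_]; last by rewrite mulr0.
by rewrite eA mem_tnth in sA.
Qed.

(** The transform of the unit vector at [A] is the indicator of the supersets of [A], hence the
    evaluation vector of the monomial of [A]. *)
Lemma mobius_load_message x : mobius setT (load_message x) = x *m G1 s.
Proof.
apply: wordP => B; rewrite mobiusT mxE.
under eq_bigr => A _ do rewrite summxE.
rewrite exchange_big /=; apply: eq_bigr => i _.
rewrite /G1 mxE Eval_monomial.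
under eq_bigr => A _ do rewrite !mxE eqxx (inj_eq (@pt_inj m)) /=.
rewrite -mulr_sumr; congr (_ * _); case sB: (tnth s i \subset B).
  by rewrite (bigD1 (tnth s i)) //= eqxx big1 ?addr0 // => A /andP[_ /negbTE ->].
by rewrite big1 // => A sA; case: eqP => // eA; rewrite -eA sA in sB.
Qed.

Lemma load_message_perm :
  exists p : 'S_(2 ^ m), forall x, col_perm p (pad0 (2 ^ m) x) = load_message x.
Proof.
case: sP => us _.
have upts : uniq [seq pt A | A <- s] by rewrite map_inj_uniq //; apply: pt_inj.
have [p pP] := perm_to_front upts; exists p => x.
apply: wordP => A; rewrite !mxE summxE.
have szs : size [seq pt A | A <- s] = qrm_dim r m by rewrite size_map size_tuple.
have [sA|sA] := boolP (A \in s).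
  have /tnthP[i eA] := sA.
  have pA : p (pt A) = i :> nat.
    case: (pP (pt A)) => [->|[_]]; last by rewrite mem_map ?sA //; apply: pt_inj.
    rewrite index_map; last exact: pt_inj.
    by rewrite eA (tnth_nth set0) index_uniq // size_tuple.
  rewrite pA valK /= (bigD1 i) //= !mxE eqxx -eA eqxx mulr1 big1 ?addr0 // => j neji.
  rewrite !mxE eqxx (inj_eq (@pt_inj m)) eA; case: eqP => [eij|_]; last by rewrite mulr0.
  by case/eqP: neji; apply/(tuple_uniqP _ us).
(* Positions outside [s] read past the first [qrm_dim r m] entries, where [pad0] takes its default
   value 0. *)
rewrite insubN /=.
  by rewrite -summxE -/(load_message x) load_message0.
have nA : pt A \notin [seq pt A | A <- s] by rewrite mem_map //; apply: pt_inj.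
rewrite -leqNgt; case: (pP (pt A)) => [->|[+ _]]; rewrite ?szs //.
by rewrite (memNindex nA) szs.
Qed.

Definition encoder_circuit (p : 'S_(2 ^ m)) : circuit (2 ^ m) :=
  [:: QPerm p, Layer [seq Hadamard h | h <- low_qubits m r]
    & encoder_layers r (enum 'I_m)].

Lemma wf_encoder_circuit p : wf_circuit (encoder_circuit p).
Proof.
rewrite /= wf_encoder_layers andbT -map_comp.
by rewrite (_ : flatten _ = low_qubits m r) ?low_qubits_uniq //; apply: flatten_seq1.
Qed.

Lemma dual_RMD w v : w \in dual (RM r m) -> v \in dual (RM r m) ->
  w + v \in dual (RM r m).
Proof. by rewrite !in_dual_RM mobiusD; apply: lowD. Qed.

Lemma encoder_circuit_ket p x :
  col_perm p (pad0 (2 ^ m) x) = load_message x ->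
  circuit_mx C (encoder_circuit p) *m ket C (pad0 (2 ^ m) x) =
    codeword C r (x *m G1 s).
Proof.
case: sP => us memsP px.
rewrite 2!circuit_cons -!mulmxA perm_ket px Hadamard_layer_ket ?low_qubits_uniq //; last first.
  (* Message sets have at least [m - r] elements, so the qubits under Hadamard gates still hold
     0. *)
  move=> j; rewrite -[j]bitsK mem_low_qubits => ltA; apply: load_message0.
  by rewrite memsP leqNgt ltA.
rewrite supported_low -scalemxAr mulmx_sumr.
under eq_bigr => c _ do rewrite encoder_layers_ket encodeD.
(* [encode] maps the words supported on the Hadamard qubits bijectively onto the dual code, so the
   normalisations agree. *)
have card_dual : #|dual (RM r m)| = (2 ^ size (low_qubits m r))%N.
  rewrite -encode_low_dual // card_imset; last exact: encode_inj.
  by rewrite -supported_low card_supported // low_qubits_uniq.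
rewrite /codeword; congr (_ *: _).
  rewrite card_dual natrX exprVn; congr (_^-1).
  by rewrite rootCX ?ler0n.
(* [d] is the discrepancy between the pruned and the full transform of the message; it lies in the
   dual code, so translation by [d] only permutes the summands. *)
set y := load_message x; pose d := encode r (enum 'I_m) y + mobius setT y.
have dd : d \in dual (RM r m).
  apply: encode_dual => A ltA; apply: load_message0.
  by rewrite memsP [(#|A| <= r)%N]leqNgt ltA andbF.
have dK : involutive (fun c : 'rV['F_2]_(2 ^ m) => d + c).
  by move=> c; apply/rowP => j; rewrite !mxE addrA F2_addxx add0r.
rewrite -(big_imset (fun c => ket C (encode r _ y + c))) /=; last first.
  by move=> c c' _ _; apply: encode_inj.
rewrite encode_low_dual // (reindex_inj (inv_inj dK)) /=.
apply: eq_big => c.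
  apply/idP/idP => dc; last exact: dual_RMD.
  by rewrite -(dK c) dual_RMD.
move=> _; congr ket; rewrite -mobius_load_message -/y /d addrA addrA.
by apply/rowP => j; rewrite !mxE F2_addxx add0r.
Qed.

End UnitaryEncoder.

Theorem mainTheorem5 :
  exists K : nat, forall (R : realType) (m r : nat),
    (1 <= m)%N -> (uphalf (m - 1) <= r <= m)%N ->
    forall s : (qrm_dim r m).-tuple {set 'I_m}, monomial_order s ->
    exists (U : 'M[R[i]]_(qdim (2 ^ m))) (c : circuit (2 ^ m)),
      [/\ unitary_encoder s U,
          wf_circuit c,
          circuit_mx R[i] c = U,
          (depth c <= K * m)%N
        & cnot_count c = zeta r m].
Proof.
(* The depth is [m + 1]: one Hadamard layer and one layer per variable; this is at most [2 * m] as
   [m] is positive. *)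
exists 2%N => R m r m_gt0 /andP[le_hr le_rm] s sP.
have mr : (m <= r.*2.+1)%N.
  by rewrite -(prednK m_gt0) ltnS -subn1 -leq_uphalf_double.
have [p pP] := load_message_perm sP.
have wfc := wf_encoder_circuit r p.
exists (circuit_mx R[i] (encoder_circuit r p)), (encoder_circuit r p); split=> //.
- split; first exact: circuit_unitary.
  by move=> x; apply: encoder_circuit_ket.
- rewrite /depth /= -/(depth _) depth_layers size_enum_ord add0n mul2n -addnn.
  by rewrite leq_add2r.
rewrite /cnot_count /= -/(cnot_count _) cnot_count_layers ?enum_uniq //.
rewrite size_enum_ord subnn mul1n zeta_cost // count_map.
by rewrite (eq_count (_ : _ =1 pred0)) ?count_pred0.
Qed.
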